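(* Let $r\ge 2$ and let $Q\subseteq P(r)$ be a nonempty set of partitions of $r$ such that neither $M=(r)$ nor $R=(1,1,\ldots,1)$ belongs to $Q$. Then the $\Sigma$-hypergraph $H=H(2r,\,r,\,(r-1)^2+1\mid \Sigma=Q)$ (which has $2r((r-1)^2+1)$ vertices) is tightly $Q$-colourable; that is: (1) there is a single integer $k$ such that $H$ has a $k$-$Q$-colouring and has no $j$-$Q$-colouring for any $j\neq k$; (2) the $k$-$Q$-colouring of $H$ is unique up to renaming the colours (any two $k$-$Q$-colourings induce the same partition of $V(H)$ into colour classes); (3) the colour classes of this colouring all have the same size; (4) for every $\pi\in Q$, $H$ has no $(Q\setminus\{\pi\})$-colouring (with any number of colours).
   Context: $P(r)$ denotes the set of all partitions of the integer $r$; $M=(r)$ is the monochromatic partition and $R=(1,1,\ldots,1)$ the rainbow partition. For $\Sigma\subseteq P(r)$ and positive integers $n,q$, the $\Sigma$-hypergraph $H(n,r,q\mid\Sigma)$ is the $r$-uniform hypergraph whose vertex set is partitioned into $n$ classes $V_1,\ldots,V_n$ of $q$ vertices each, in which an $r$-subset $K$ of vertices is an edge iff the partition of $r$ formed by the nonzero numbers $|K\cap V_i|$, $1\le i\le n$, belongs to $\Sigma$. Given a vertex colouring of an $r$-uniform hypergraph, the pattern $pat(E)$ of an edge $E$ is the partition of $r$ formed by the numbers of vertices of $E$ of each colour appearing in $E$. For $Q\subseteq P(r)$, a $Q$-colouring is a vertex colouring in which $pat(E)\in Q$ for every edge $E$; a $k$-$Q$-colouring is a $Q$-colouring using exactly $k$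 colours (each of the $k$ colours is used on at least one vertex). *)

(* Defs.v *)
From mathcomp Require Import all_boot.

Set Implicit Arguments.
Unset Strict Implicit.
Unset Printing Implicit Defensive.

(* An integer partition is the nonincreasing list of its (positive) parts. *)
Definition int_partition (r : nat) : {pred seq nat} :=
  [pred s | [&& sorted geq s, 0 \notin s & sumn s == r]].

Definition monochromatic (r : nat) : seq nat := [:: r].

Definition rainbow (r : nat) : seq nat := nseq r 1.

(* The partition of #|K| formed by the nonzero numbers of elements of K in the
   fibres of f. With f a colouring this is pat(K); with f the map sending a
   vertex to its class it is the partition that decides whether K is an edge
   of a Sigma-hypergraph. *)
Definition pattern (V C : finType) (f : V -> C) (K : {set V}) : seq nat :=
  sort geq [seq m <- [seq #|[set v in K | f v == i]| | i : C] | 0 < m].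

(* The vertex (i, j) is the j-th vertex of the class V_i; a hypergraph is
   given by its set of edges. *)
Definition sigma_hypergraph (n r q : nat) (Sigma : {pred seq nat}) :
    {set {set 'I_n * 'I_q}} :=
  [set K : {set 'I_n * 'I_q} | (#|K| == r) && (pattern fst K \in Sigma)].

Section Colouring.

Variables (V : finType) (H : {set {set V}}) (Q : {pred seq nat}).

Definition Q_colouring (C : finType) (c : V -> C) : Prop :=
  forall E : {set V}, E \in H -> pattern c E \in Q.

Definition k_Q_colouring (k : nat) (c : V -> 'I_k) : Prop :=
  Q_colouring c /\ (forall i : 'I_k, exists v : V, c v = i).

End Colouring.

Definition colour_classes (V C : finType) (c : V -> C) : {set {set V}} :=
  preim_partition c [set: V].

Definition tightly_Q_colourable (V : finType) (H : {set {set V}})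
    (Q : {pred seq nat}) : Prop :=
  (exists k : nat,
    [/\ exists c : V -> 'I_k, k_Q_colouring H Q c,
        forall (j : nat) (c : V -> 'I_j), j <> k -> ~ k_Q_colouring H Q c,
        forall c1 c2 : V -> 'I_k,
          k_Q_colouring H Q c1 -> k_Q_colouring H Q c2 ->
          colour_classes c1 = colour_classes c2
      & forall c : V -> 'I_k, k_Q_colouring H Q c ->
          {in colour_classes c &, forall A B : {set V}, #|A| = #|B|}])
  /\ (forall pi : seq nat, pi \in Q ->
        forall (C : finType) (c : V -> C),
          ~ Q_colouring H [predD1 Q & pi] c).

(* Main.v *)
(** Fix a [Q]-colouring. A class meeting at least [r] colours can supply any
    part of an edge with fresh colours, so [r] such classes would contain a
    rainbow edge. Hence more than [r] classes use at most [r - 1] colours, and by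
    pigeonhole on [(r - 1) ^ 2 + 1] vertices each of them has a colour used at
    least [r] times. If two of these colours coincided, an edge with a shortest
    class pattern in [Q] could be chosen with a strictly shorter colour pattern;
    so they are distinct. If some class had two colours, an edge with a longest
    class pattern could be chosen with a strictly longer colour pattern; so
    every class is monochromatic, and the colour classes are exactly the
    classes [V_i]. *)

Require Import Defs.
From mathcomp Require Import all_boot.
From mathcomp Require Import zify.

Set Implicit Arguments.
Unset Strict Implicit.
Unset Printing Implicit Defensive.

(** * Patterns of vertex sets and the fibres of a map *)

Section Patterns.

Variables (V C : finType) (f : V -> C).

Lemma size_pattern (K : {set V}) : size (pattern f K) = #|f @: K|.
Proof.
rewrite size_sort filter_map size_map size_filter -sum1_count big_enum_cond /=.
rewrite sum1_card; apply: eq_card => i;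
  rewrite -[LHS]/(0 < #|[set v in K | f v == i]|) card_gt0.
apply/set0Pn/imsetP => [[v] | [v vK ->]].
  by rewrite inE => /andP[vK /eqP <-]; exists v.
by exists v; rewrite inE vK eqxx.
Qed.

Lemma sumn_pattern (K : {set V}) : sumn (pattern f K) = #|K|.
Proof.
rewrite (perm_sumn (permEl (perm_sort _ _))).
have -> (s : seq nat) : sumn [seq m <- s | 0 < m] = sumn s.
  by elim: s => //= -[|m] s /= ->.
rewrite sumnE big_map big_enum -sum1_card (partition_big f predT) //=.
by apply: eq_bigr => i _; rewrite -sum1_card; apply: eq_bigl => v; rewrite inE.
Qed.

(** Both lists are sorted, so it suffices that they are permutations of each other. As [s] has no
    zero, [js] lists exactly the values taken on [K], and the zeros filtered out come from values
    outside [js]. *)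
Lemma pattern_fibres (K : {set V}) (js : seq C) (s : seq nat) :
  sorted geq s -> 0 \notin s -> uniq js -> {in K, forall v, f v \in js} ->
  [seq #|[set v in K | f v == i]| | i <- js] = s -> pattern f K = s.
Proof.
move=> s_sorted s_pos js_uniq fK Es.
apply: (@sorted_eq _ geq) => //.
- by move=> ? ? ? /= h1 h2; apply: leq_trans h2 h1.
- by move=> x y /=; rewrite andbC -eqn_leq => /eqP.
- by apply: sort_sorted => x y /=; apply: leq_total.
rewrite perm_sort filter_map -[s in perm_eq _ s]Es; apply/perm_map/uniq_perm => //.
  by rewrite filter_uniq ?enum_uniq.
move=> i; rewrite mem_filter mem_enum andbT /=.
apply/idP/idP => [|ijs].
  by rewrite card_gt0 => /set0Pn[v]; rewrite inE => /andP[/fK + /eqP <-].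
rewrite lt0n; apply: contra s_pos => /eqP i0.
by rewrite -Es -[X in X \in _]i0; apply/mapP; exists i.
Qed.

(** Lets an edge be assembled from blocks chosen separately in each fibre. *)
Lemma card_glued_fibres (js : seq C) (B : C -> {set V}) :
  {in js, forall i, {in B i, forall v, f v = i}} ->
  [seq #|[set v in [set v | (f v \in js) && (v \in B (f v))] | f v == i]|
    | i <- js] = [seq #|B i| | i <- js].
Proof.
move=> fB; apply/eq_in_map => i ijs /=; congr #|pred_of_set _|; apply/setP => v.
rewrite !inE; apply/andP/idP => [[/andP[_ vB] /eqP <-] // | vB].
by rewrite (fB i) // ijs vB eqxx.
Qed.

Lemma rainbow_subset (A : {set V}) (k : nat) : k <= #|f @: A| ->
  exists B : {set V}, [/\ B \subset A, #|B| = k & {in B &, injective f}].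
Proof.
move=> /card_geqP[s [s_uniq <- sA]].
suff [B []]: exists B : {set V},
    [/\ B \subset A, #|B| = size s, {in B &, injective f}
      & {in B, forall v, f v \in s}] by exists B.
elim: s s_uniq sA => [_ _ | x s IH /= /andP[xs s_uniq] sA].
  by exists set0; split; rewrite ?sub0set ?cards0 // => u; rewrite inE.
have [|B [BA cB injB fB]] := IH s_uniq.
  by move=> z zs; apply: sA; rewrite inE zs orbT.
have /imsetP[v vA xE] := sA x (mem_head _ _).
have vB u : u \in B -> f u <> f v.
  by move=> /fB uB uv; rewrite xE -uv uB in xs.
exists (v |: B); split.
- by rewrite subUset sub1set vA.
- by rewrite cardsU1 cB; case: (boolP (v \in B)) => // /vB.
- move=> u w /setU1P[-> | uB] /setU1P[-> | wB] // fuw.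
  + by case: (vB w).
  + by case: (vB u).
  + exact: injB.
- by move=> u /setU1P[-> | /fB uB]; rewrite inE ?xE ?eqxx // uB orbT.
Qed.

End Patterns.

(** * Parts and lengths of integer partitions *)

Lemma leq_nth_sumn (s : seq nat) (k : nat) : nth 0 s k <= sumn s.
Proof.
elim: s k => [|a s IH] [|k] //=; first exact: leq_addr.
exact: leq_trans (IH k) (leq_addl _ _).
Qed.

Lemma map_nth_index (T : eqType) (js : seq T) (s : seq nat) :
  uniq js -> size js = size s -> [seq nth 0 s (index i js) | i <- js] = s.
Proof.
move=> js_uniq Es; apply: (@eq_from_nth _ 0); rewrite size_map // => k kjs.
by case: js js_uniq Es kjs => // x js js_uniq _ kjs;
   rewrite (nth_map x) // index_uniq.
Qed.

Lemma size_positive_seq (s : seq nat) : 0 \notin s ->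
  size s <= sumn s /\ (sumn s <= size s -> s = nseq (size s) 1).
Proof.
elim: s => [|[|a] s IH] //=; rewrite inE /= => /IH[IH1 IH2]; split; first lia.
move=> les; have a0 : a = 0 by lia.
by rewrite a0 -IH2 //; lia.
Qed.

Lemma size_int_partition (r : nat) (s : seq nat) :
  0 < r -> s \in int_partition r -> s <> monochromatic r -> s <> rainbow r ->
  1 < size s < r.
Proof.
move=> r_gt0 /and3P[_ s_pos /eqP Er] sM sR.
have [les ges] := size_positive_seq s_pos; apply/andP; split.
  case: s Er sM {les ges s_pos sR} => [|a [|b s]] //= Er; first by lia.
  by case; rewrite /monochromatic -Er addn0.
rewrite ltn_neqAle -{2}Er les andbT; apply/eqP => szr.
by apply: sR; rewrite ges ?szr ?Er.
Qed.

(** The head is the largest part: were it 1, all parts would be 1 and their number would be [r]. *)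
Lemma leq_head_int_partition (r : nat) (a : nat) (s : seq nat) :
  a :: s \in int_partition r -> (size s).+1 < r -> 1 < a.
Proof.
move=> /and3P[as_sorted _ /eqP /= <-]; case: a as_sorted => [|[|a]] //= as_sorted.
  suff -> : sumn s = 0 by [].
  by elim: s as_sorted => //= b s IH /andP[]; rewrite leqn0 => /eqP-> /IH.
suff : sumn s <= size s by lia.
have : all (geq 1) s.
  by apply: order_path_min as_sorted => ? ? ? /= h1 h2; apply: leq_trans h2 h1.
by elim: s {as_sorted} => //= b s IH /andP[b1 /IH]; lia.
Qed.

(** * Subsets of prescribed size *)

Section Draw.

Variable T : finType.

Definition draw (k : nat) (A : {set T}) : {set T} := [set x in take k (enum A)].

Lemma draw_sub (k : nat) (A : {set T}) : draw k A \subset A.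
Proof. by apply/subsetP => x; rewrite inE => /mem_take; rewrite mem_enum. Qed.

Lemma card_draw (k : nat) (A : {set T}) : k <= #|A| -> #|draw k A| = k.
Proof.
move=> kA; rewrite cardsE; have /card_uniqP-> := take_uniq k (enum_uniq A).
by rewrite size_takel // -cardE.
Qed.

End Draw.

(** * Rigidity of a colouring [c] relative to an abstract class map [p] *)

Section Colouring.

Variables (V I C : finType) (p : V -> I) (c : V -> C) (r : nat).
Variable Q : {pred seq nat}.

Hypothesis r_gt1 : 1 < r.
Hypothesis QP : {subset Q <= int_partition r}.
Hypothesis QM : monochromatic r \notin Q.
Hypothesis QR : rainbow r \notin Q.
Hypothesis Q_ex : exists pi, pi \in Q.
Hypothesis card_I : 2 * r <= #|I|.
Hypothesis card_fibre : forall i, (r - 1) ^ 2 < #|[set v | p v == i]|.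
Hypothesis Qc : forall K : {set V}, #|K| = r -> pattern p K \in Q ->
  pattern c K \in Q.

Lemma size_Q (pi : seq nat) : pi \in Q -> 1 < size pi < r.
Proof.
move=> piQ; apply: size_int_partition (QP piQ) _ _; first exact: ltnW.
- by move=> E; rewrite E (negPf QM) in piQ.
- by move=> E; rewrite E (negPf QR) in piQ.
Qed.

Lemma leq_card_fibre (i : I) : r <= #|[set v | p v == i]|.
Proof. by apply: leq_trans (card_fibre i); clear -r_gt1; nia. Qed.

Lemma edge_pattern (pi : seq nat) (js : seq I) (K : {set V}) :
  pi \in Q -> uniq js -> {in K, forall v, p v \in js} ->
  [seq #|[set v in K | p v == i]| | i <- js] = pi -> pattern c K \in Q.
Proof.
move=> piQ js_uniq pK Epi; have /and3P[pi_sorted pi_pos /eqP pi_sum] := QP piQ.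
have Kpi := pattern_fibres pi_sorted pi_pos js_uniq pK Epi.
by apply: Qc; rewrite -?(sumn_pattern p) Kpi.
Qed.

Definition cell (i : I) (x : C) : {set V} := [set v | (p v == i) && (c v == x)].

(** The first part is realised by [A], every other part by a block inside one cell. The colours of
    the edge are thus known exactly, and their number is the length of its colour pattern. *)
Lemma edge_cells (m : I -> C) (a : nat) (s : seq nat) (i : I) (js : seq I)
    (A : {set V}) :
  a :: s \in Q -> uniq (i :: js) -> size js = size s ->
  {in A, forall v, p v = i} -> #|A| = a ->
  {in js, forall k, r <= #|cell k (m k)|} ->
  exists2 K, pattern c K \in Q & c @: K = c @: A :|: [set x in map m js].
Proof.
move=> asQ /= /andP[ijs js_uniq] szjs pA cA mjs.
have /and3P[_ as_pos /eqP /= as_sum] := QP asQ.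
pose w k := nth 0 s (index k js).
pose B k := if k == i then A else draw (w k) (cell k (m k)).
have Bi : B i = A by rewrite /B eqxx.
have Bjs k : k \in js -> B k = draw (w k) (cell k (m k)).
  by rewrite /B; case: eqP => // ->; rewrite (negPf ijs).
have cB k : k \in js -> #|B k| = w k.
  move=> kjs; rewrite Bjs // card_draw //; apply: leq_trans (mjs k kjs).
  by rewrite -as_sum; apply: leq_trans (leq_nth_sumn _ _) (leq_addl _ _).
have Bjs_in k v : k \in js -> v \in B k -> p v = k /\ c v = m k.
  move=> kjs; rewrite Bjs // => /(subsetP (draw_sub _ _)).
  by rewrite inE => /andP[/eqP-> /eqP->].
have pB : {in i :: js, forall k, {in B k, forall v, p v = k}}.
  move=> k; rewrite inE => /predU1P[-> v | kjs v /Bjs_in[] //].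
  by rewrite Bi; apply: pA.
exists [set v | (p v \in i :: js) && (v \in B (p v))].
  apply: (edge_pattern asQ (js := i :: js)); rewrite /= ?ijs //.
    by move=> v; rewrite inE => /andP[].
  have /= -> := card_glued_fibres pB.
  rewrite Bi cA; congr cons; rewrite -[RHS](map_nth_index js_uniq szjs).
  by apply/eq_in_map => k /cB.
apply/setP => x; rewrite !inE; apply/imsetP/orP => [[v] | [] ].
- rewrite inE => /andP[]; rewrite inE => /predU1P[pv | pvjs] vB ->.
    by left; apply/imset_f; rewrite -Bi -pv.
  by right; apply/mapP; exists (p v) => //; case: (Bjs_in _ _ pvjs vB).
- case/imsetP => v vA ->; exists v => //.
  by rewrite !inE (pA v vA) eqxx Bi.
case/mapP => k kjs ->.
(* Parts are positive, so no block is empty and each colour [m k] does occur. *)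
have /card_gt0P[v vB] : 0 < #|B k|.
  rewrite cB // lt0n; apply: contra as_pos => /eqP w0.
  by rewrite inE -w0 mem_nth ?orbT // -szjs index_mem.
have [pv cv] := Bjs_in _ _ kjs vB; exists v => //.
by rewrite inE pv vB inE kjs orbT.
Qed.

(* The minimality argument is run as a descent on [size pi], as [Q] is only a
   predicate on an infinite type. *)
Lemma majority_inj (M : {set I}) (m : I -> C) : r <= #|M| ->
  {in M, forall i, r <= #|cell i (m i)|} -> {in M &, injective m}.
Proof.
move=> rM mM i j iM jM mij; apply/eqP; apply: contraT => ij.
suff noQ n pi : size pi = n -> pi \notin Q.
  by case: Q_ex => pi; apply: contraLR => _; apply: noQ.
elim/ltn_ind: n pi => n IH pi szpi; apply/negP => piQ.
have /andP[pi_gt1 pi_ltr] := size_Q piQ.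
case: pi szpi piQ pi_gt1 pi_ltr => [|a [|b s]] // szn sQ _ szr.
(* Classes [i] and [j] take the two largest parts; as [pi] has fewer than [r] parts, [M] has enough
   other classes for the rest. *)
have /card_geqP[js [js_uniq szjs jsM]] : size s <= #|M :\ i :\ j|.
  move: rM szr; rewrite (cardsD1 i) iM (cardsD1 j) !inE jM eq_sym ij /=; lia.
have ajsM : {subset js <= M} by move=> k /jsM; rewrite !inE => /and3P[].
have jjsM : {in j :: js, forall k, r <= #|cell k (m k)|}.
  by move=> k; rewrite inE => /predU1P[-> | /ajsM kM]; apply: mM.
have le_ar : a <= #|cell i (m i)|.
  apply: leq_trans (mM i iM); have /and3P[_ _ /eqP <-] := QP sQ.
  exact: leq_addr.
have ijs_uniq : uniq [:: i, j & js].
  rewrite /= inE negb_or ij js_uniq andbT /=.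
  by apply/andP; split; apply/negP => /jsM; rewrite !inE eqxx ?andbF.
have szj : size (j :: js) = size (b :: s) by rewrite /= szjs.
have pA : {in draw a (cell i (m i)), forall v, p v = i}.
  by move=> v /(subsetP (draw_sub _ _)); rewrite inE => /andP[/eqP].
have [K KQ cK] := edge_cells sQ ijs_uniq szj pA (card_draw le_ar) jjsM.
(* The blocks in [i] and [j] share a colour, so the edge has fewer colours than [pi] has parts. *)
suff lt_n : size (pattern c K) < n by have := IH _ lt_n _ erefl; rewrite KQ.
rewrite size_pattern cK (setUidPr _).
  rewrite cardsE -szn; apply: leq_ltn_trans (card_size _) _.
  by rewrite size_map szj.
apply/subsetP => x /imsetP[v /(subsetP (draw_sub _ _)) v_cell ->].
by move: v_cell; rewrite !inE mij => /andP[_ ->].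
Qed.

(** Dual descent, on [r - size pi]: two colours inside one class turn each member of [Q] into a
    strictly longer one, while lengths in [Q] stay below [r]. *)
Lemma fibre_monochromatic (M : {set I}) (m : I -> C) : r < #|M| ->
  {in M, forall i, r <= #|cell i (m i)|} ->
  forall u v, p u = p v -> c u = c v.
Proof.
move=> rM mM u v puv; apply/eqP; apply: contraT => cuv.
have m_inj := majority_inj (ltnW rM) mM.
have uv : u != v by apply: contra cuv => /eqP->.
suff noQ n pi : r - size pi = n -> pi \notin Q.
  by case: Q_ex => pi; apply: contraLR => _; apply: noQ.
elim/ltn_ind: n pi => n IH pi szpi; apply/negP => piQ.
have /andP[pi_gt1 pi_ltr] := size_Q piQ.
case: pi szpi piQ pi_gt1 pi_ltr => [|a s] // szn sQ _ szr.
have a_gt1 := leq_head_int_partition (QP sQ) szr.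
have /and3P[_ s_pos /eqP /= s_sum] := QP sQ.
have les : size s <= sumn s.
  by apply: (size_positive_seq _).1; apply: contra s_pos => h; rewrite inE h orbT.
set i := p u.
(* The largest part is at least 2, so its block has room for both [u] and [v] and carries at least
   two colours. *)
pose A := [set u; v] :|: draw (a - 2) ([set w | p w == i] :\ u :\ v).
have pA : {in A, forall w, p w = i}.
  move=> w; rewrite !in_setU !in_set1 => /orP[/orP[] /eqP-> // |].
  by move=> /(subsetP (draw_sub _ _)); rewrite !inE => /and3P[_ _ /eqP].
have cA : #|A| = a.
  rewrite cardsU cards2 uv card_draw.
    rewrite (_ : _ :&: _ = set0) ?cards0; first by lia.
    apply/setP => w; rewrite in_setI in_set2 in_set0; apply/negP.
    case/andP => wuv /(subsetP (draw_sub _ _)); rewrite !inE.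
    by case/orP: wuv => /eqP->; rewrite eqxx ?andbF.
  have := leq_card_fibre i.
  rewrite (cardsD1 u) (cardsD1 v) !inE eqxx -puv eqxx eq_sym uv /=; lia.
(* Classes to avoid: that of [u], and those whose majority colour already occurs on [A]. Injectivity
   of [m] bounds the latter by [a], so the strict bound [r < #|M|] leaves at least [r - a] classes,
   enough for the remaining parts. *)
pose Bad := i |: [set k in M | m k \in c @: A].
have BadM : #|Bad| <= a.+1.
  rewrite cardsU1 -add1n; apply: leq_add; first by case: (_ \notin _).
  rewrite -cA; apply: leq_trans (leq_imset_card c _).
  rewrite -(card_in_imset (f := m)) ?subset_leq_card //.
    by apply/subsetP => x /imsetP[k]; rewrite inE => /andP[_ +] ->.
  by move=> x y; rewrite !inE => /andP[xM _] /andP[yM _]; apply: m_inj.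
have /card_geqP[js [js_uniq szjs jsM]] : size s <= #|M :\: Bad|.
  have := cardsID Bad M; have := subset_leq_card (subsetIr M Bad).
  move: s_sum les rM BadM; set x := #|_|; set y := #|_|; set z := #|_|; lia.
have jsP k : k \in js -> [/\ k \in M, k != i & m k \notin c @: A].
  move/jsM; rewrite !inE negb_or; case: (k \in M); rewrite ?andbF //= andbT.
  by case/andP.
have jsm : {in js, forall k, r <= #|cell k (m k)|}.
  by move=> k /jsP[kM _ _]; apply: mM.
have ijs_uniq : uniq (i :: js).
  by rewrite /= js_uniq andbT; apply/negP => /jsP[]; rewrite eqxx.
have [K KQ cK] := edge_cells sQ ijs_uniq szjs pA cA jsm.
suff lt_n : r - size (pattern c K) < n by have := IH _ lt_n _ erefl; rewrite KQ.
(* At least two colours on [A], plus one new colour for each remaining part. *)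
suff : (size s).+1 < size (pattern c K).
  by have /andP[_] := size_Q KQ; rewrite -szn /=; lia.
rewrite size_pattern cK cardsU (_ : _ :&: _ = set0); last first.
  apply/setP => x; rewrite in_setI in_set0 inE; apply/negP => /andP[xA].
  by case/mapP => k /jsP[_ _ +] xE; rewrite -xE xA.
rewrite cards0 subn0 cardsE.
have /card_uniqP-> : uniq (map m js).
  rewrite map_inj_in_uniq // => x y /jsP[xM _ _] /jsP[yM _ _].
  exact: m_inj.
rewrite size_map szjs -addn2 addnC leq_add2r.
suff : #|[set c u; c v]| <= #|c @: A| by rewrite cards2 cuv.
apply/subset_leq_card/subsetP => x /set2P[]->; apply/imset_f;
  by rewrite !inE eqxx ?orbT.
Qed.

Lemma rainbow_transversal (js : seq I) (s : seq nat) :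
  uniq js -> size js = size s -> sumn s <= r ->
  {in js, forall i, r <= #|c @: [set v | p v == i]|} ->
  exists K : {set V}, [/\ {in K &, injective c}, {in K, forall v, p v \in js}
    & [seq #|[set v in K | p v == i]| | i <- js] = s].
Proof.
elim: js s => [|i js IH] [|a s] //=.
  by move=> _ _ _ _; exists set0; split => // u; rewrite inE.
case/andP=> ijs js_uniq [szjs] sum_le_r jsr.
have [||K [K_inj pK Ks]] := IH s js_uniq szjs.
- exact: leq_trans (leq_addl _ _) sum_le_r.
- by move=> k kjs; apply: jsr; rewrite inE kjs orbT.
have cK : #|K| = sumn s.
  rewrite -Ks sumnE big_map big_uniq //= -[LHS]sum1_card.
  rewrite (partition_big p (mem js)) //=.
  by apply: eq_bigr => k _; rewrite -sum1_card; apply: eq_bigl => v; rewrite inE.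
pose F := [set v in [set v | p v == i] | c v \notin c @: K].
have aF : a <= #|c @: F|.
  have sub : c @: [set v | p v == i] \subset c @: F :|: c @: K.
    apply/subsetP => x /imsetP[v vi ->]; rewrite inE orbC.
    case: (boolP (c v \in _)) => //= cv.
    by apply: imset_f; rewrite inE vi.
  have := leq_trans (jsr i (mem_head _ _)) (subset_leq_card sub).
  have := leq_of_leqif (leq_card_setU (c @: F) (c @: K)).
  have := leq_imset_card c K; rewrite cK; lia.
have [D [DF cD D_inj]] := rainbow_subset aF.
have pD v : v \in D -> p v = i.
  by move/(subsetP DF); rewrite !inE => /andP[/eqP].
have cDK u v : u \in D -> v \in K -> c u <> c v.
  by move=> /(subsetP DF); rewrite inE => /andP[_ +] vK uv; rewrite uv imset_f.
exists (D :|: K); split.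
- move=> u v /setUP[uD | uK] /setUP[vD | vK] uv; first exact: D_inj.
  + by case: (cDK u v).
  + by case: (cDK v u).
  + exact: K_inj.
- by move=> v /setUP[/pD-> | /pK vjs]; rewrite inE ?eqxx // vjs orbT.
congr cons.
  rewrite -cD; congr #|pred_of_set _|; apply/setP => v; rewrite !inE.
  apply/andP/idP => [[/orP[] // /pK pv /eqP pvi] | vD].
    by rewrite pvi (negPf ijs) in pv.
  by rewrite vD (pD v vD) eqxx.
rewrite -Ks; apply/eq_in_map => k kjs; congr #|pred_of_set _|; apply/setP => v.
rewrite !inE; case: (boolP (v \in D)) => //= vD; rewrite (pD v vD).
by case: eqP => [ik|_]; [rewrite ik kjs in ijs | rewrite andbF].
Qed.

(** Otherwise some edge would have [r] distinct colours, whereas patterns in [Q] have fewer than [r]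
    parts. *)
Lemma card_many_coloured_fibres :
  #|[set i | r <= #|c @: [set v | p v == i]|]| < r.
Proof.
rewrite ltnNge; apply/negP => rB; have [pi piQ] := Q_ex.
have /andP[_ pi_ltr] := size_Q piQ.
have /card_geqP[js [js_uniq szjs jsB]] := leq_trans (ltnW pi_ltr) rB.
have /and3P[_ _ /eqP pi_sum] := QP piQ.
have [||K [K_inj pK Ks]] := rainbow_transversal js_uniq szjs.
- by rewrite pi_sum.
- by move=> i /jsB; rewrite inE.
have KQ := edge_pattern piQ js_uniq pK Ks.
have /andP[_] := size_Q KQ; have /and3P[_ _ /eqP] := QP KQ.
by rewrite sumn_pattern size_pattern card_in_imset // => ->; rewrite ltnn.
Qed.

(** Pigeonhole: at most [r - 1] colours, each used at most [r - 1] times, would cover only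
    [(r - 1) ^ 2] vertices. *)
Lemma ex_majority (i : I) : #|c @: [set v | p v == i]| < r ->
  exists x, r <= #|cell i x|.
Proof.
move=> few; apply/existsP; apply: contraT; rewrite negb_exists => /forallP lt_r.
have := card_fibre i; rewrite ltnNge => /negP[].
rewrite -sum1_card (partition_big c (mem (c @: [set v | p v == i]))) /=; last first.
  by move=> v vi; apply: imset_f.
apply: (@leq_trans (\sum_(x in c @: [set v | p v == i]) (r - 1))).
  apply: leq_sum => x _; have := lt_r x; rewrite -ltnNge -sum1_card.
  rewrite (eq_bigl (fun v => (v \in [set v | p v == i]) && (c v == x))); first lia.
  by move=> v; rewrite !inE.
by rewrite sum_nat_const expnS expn1 leq_mul2r; apply/orP; right; lia.
Qed.

Lemma colouring_eq (u v : V) : (c u == c v) = (p u == p v).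
Proof.
(* The default [c u] only makes [m] total; it is returned only when class [i] has no majority
   colour. *)
pose m i := odflt (c u) [pick x | r <= #|cell i x|].
have mP i : (exists x, r <= #|cell i x|) -> r <= #|cell i (m i)|.
  by rewrite /m; case: pickP => //= no [x]; rewrite no.
(* Fewer than [r] of the at least [2 * r] classes are discarded, so more than [r] remain. *)
pose M := ~: [set i | r <= #|c @: [set v | p v == i]|].
have rM : r < #|M|.
  have := cardsC [set i | r <= #|c @: [set v | p v == i]|].
  by have := card_many_coloured_fibres; rewrite -/M; move: card_I; lia.
have mono : forall u v, p u = p v -> c u = c v.
  apply: (fibre_monochromatic rM) => i; rewrite !inE -ltnNge => /ex_majority.
  exact: mP.
(* Once classes are known to be monochromatic, even the discarded ones have a majority colour, so
   injectivity of [m] extends to all classes. *)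
have mT : {in [set: I], forall i, r <= #|cell i (m i)|}.
  move=> i _; apply: mP.
  have /card_gt0P[w] : 0 < #|[set v | p v == i]| by exact: leq_trans (card_fibre i).
  rewrite inE => /eqP wi; exists (c w); apply: leq_trans (leq_card_fibre i) _.
  apply/subset_leq_card/subsetP => x; rewrite !inE => /eqP xi.
  by rewrite xi (mono x w) ?xi ?wi ?eqxx.
have cm w : c w = m (p w).
  have /card_gt0P[x] : 0 < #|cell (p w) (m (p w))|.
    by apply: leq_trans (mT (p w) _); rewrite ?inE //; apply: ltnW.
  by rewrite inE => /andP[/eqP/mono-> /eqP].
apply/eqP/eqP => [|/mono //]; rewrite !cm.
by apply: (majority_inj _ mT); rewrite ?inE // cardsT; move: card_I; lia.
Qed.

End Colouring.

(** * Tight colourability of the hypergraph *)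

Theorem theorem2p1 (r : nat) (Q : {pred seq nat})
    (hr : 2 <= r)
    (hQ : {subset Q <= int_partition r})
    (hQ0 : exists pi : seq nat, pi \in Q)
    (hM : monochromatic r \notin Q)
    (hR : rainbow r \notin Q) :
  tightly_Q_colourable (sigma_hypergraph (2 * r) r ((r - 1) ^ 2 + 1) Q) Q.
Proof.
set q := (r - 1) ^ 2 + 1; set H := sigma_hypergraph _ _ _ _.
have q_gt0 : 0 < q by rewrite /q addn1.
have card_class (i : 'I_(2 * r)) : #|[set v : 'I_(2 * r) * 'I_q | v.1 == i]| = q.
  rewrite -[RHS]card_ord -[RHS](card_imset (f := pair i)); last by move=> ? ? [].
  apply: eq_card => -[k j]; rewrite inE /=.
  by apply/eqP/imsetP => [-> | [? _ [->]]] //; exists j.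
have class_large (i : 'I_(2 * r)) :
    (r - 1) ^ 2 < #|[set v : 'I_(2 * r) * 'I_q | v.1 == i]|.
  by rewrite card_class /q addn1.
have colE (C : finType) (c : 'I_(2 * r) * 'I_q -> C) :
    Q_colouring H Q c -> forall u v, (c u == c v) = (u.1 == v.1).
  move=> cQ; apply: (colouring_eq hr hQ hM hR hQ0) => //; first by rewrite card_ord.
  by move=> K Kr KQ; apply: cQ; rewrite inE Kr eqxx.
have classesE (C : finType) (c : 'I_(2 * r) * 'I_q -> C) :
    Q_colouring H Q c -> colour_classes c = colour_classes fst.
  move=> cQ; apply: eq_in_imset => u _; apply/setP => v; rewrite !inE /=.
  exact: colE.
pose base i : 'I_(2 * r) * 'I_q := (i, Ordinal q_gt0).
split.
  exists (2 * r); split.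
  (* Colouring each vertex by its class works because the colour pattern of an edge is then its
     class pattern. *)
  - exists fst; split; first by move=> E; rewrite inE => /andP[].
    by move=> i; exists (base i).
  - move=> j c jr [cQ c_surj]; apply: jr.
    (* One representative per class receives each colour exactly once, which forces [j] to equal the
       number of classes. *)
    have base_inj : injective (c \o base).
      by move=> x y /eqP; rewrite /= (colE _ _ cQ) => /eqP.
    have := card_imset predT base_inj; rewrite !card_ord => <-.
    rewrite -[LHS]card_ord; apply: eq_card => x; rewrite inE.
    have [v <-] := c_surj x; apply/esym/imsetP; exists v.1 => //.
    by apply/eqP; rewrite /= (colE _ _ cQ).
  - by move=> c1 c2 [/classesE-> _] [/classesE-> _].
  - move=> c [/classesE-> _].
    suff cq : {in colour_classes (@fst 'I_(2 * r) 'I_q), forall A : {set _}, #|A| = q}.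
      by move=> A B AP BP; rewrite !cq.
    move=> A /imsetP[u _ ->]; rewrite -[RHS](card_class u.1).
    by apply: eq_card => v; rewrite !inE /= eq_sym.
(* For the last claim, an edge with class pattern [pi] is built. The given colouring is also a
   [Q]-colouring, so its colour classes are the classes, and the edge has the forbidden colour
   pattern [pi]. *)
move=> pi piQ C c cQpi.
have cQ : Q_colouring H Q c by move=> E /cQpi; rewrite inE => /andP[].
have colc := colE _ _ cQ.
have /and3P[pi_sorted pi_pos /eqP pi_sum] := hQ _ piQ.
have /andP[_ pi_ltr] := size_Q hr hQ hM hR piQ.
have /card_geqP[js [js_uniq szjs _]] : size pi <= #|'I_(2 * r)|.
  by rewrite card_ord; lia.
pose B i := draw (nth 0 pi (index i js)) [set v : 'I_(2 * r) * 'I_q | v.1 == i].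
have B1 : {in js, forall i, {in B i, forall v, v.1 = i}}.
  by move=> i _ v /(subsetP (draw_sub _ _)); rewrite inE => /eqP.
set K := [set v | (v.1 \in js) && (v \in B v.1)].
have Kpi : [seq #|[set v in K | v.1 == i]| | i <- js] = pi.
  rewrite card_glued_fibres // -[RHS](map_nth_index js_uniq szjs).
  apply/eq_in_map => i _; rewrite card_draw // (leq_trans (leq_nth_sumn _ _)) //.
  by rewrite pi_sum; apply: (leq_card_fibre hr class_large).
have K1 : {in K, forall v, v.1 \in js} by move=> v; rewrite inE => /andP[].
have pat1 := pattern_fibres pi_sorted pi_pos js_uniq K1 Kpi.
have KH : K \in H.
  by rewrite inE pat1 piQ andbT -(sumn_pattern fst) pat1 pi_sum.
have cbase v : c v = c (base v.1) by apply/eqP; rewrite colc.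
have pat2 : pattern c K = pi.
  apply: (@pattern_fibres _ _ _ _ (map (c \o base) js)) => //.
  - rewrite map_inj_uniq // => x y /eqP; rewrite /= colc => /eqP //.
  - by move=> v /K1 vjs; rewrite cbase; apply/mapP; exists v.1.
  rewrite -map_comp -[RHS]Kpi; apply: eq_map => i /=.
  by apply: eq_card => v; rewrite !inE colc.
by have := cQpi K KH; rewrite pat2 !inE eqxx.
Qed.
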